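(* Let $Q\in\mathbb{R}^{n\times n}$ be invertible, let $\boldsymbol{a}=n^{-1/2}\mathbf{1}\in\mathbb{R}^n$, where $\mathbf{1}$ is the all-ones vector, and let $\boldsymbol{b}=Q^{-1}\boldsymbol{a}$. Suppose the entries of $\boldsymbol{b}$ are pairwise distinct, i.e. $b_i=b_j\Rightarrow i=j$. Let $P_b$ be the permutation matrix that puts $\boldsymbol{b}$ in ascending order, i.e. $(P_b\boldsymbol{b})_1<(P_b\boldsymbol{b})_2<\cdots<(P_b\boldsymbol{b})_n$. Then for every $n\times n$ permutation matrix $P^*$ there exists $\delta>0$ such that, with $\boldsymbol{\epsilon}=\delta[1,2,\dots,n]^T$, the vector $$\boldsymbol{x}=\boldsymbol{b}+Q^{-1}P^*P_b^T\boldsymbol{\epsilon}\in\mathbb{R}^n$$ satisfies $$P^*=\arg\min_{P\in\mathsf{P}}\|Q\boldsymbol{x}-P\boldsymbol{x}\|_{\rm F}^2 .$$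
   Context: $\mathsf{P}$ is the set of $n\times n$ permutation matrices. On column vectors the Frobenius norm $\|\cdot\|_{\rm F}$ is the Euclidean norm. ''$P^*=\arg\min_{P\in\mathsf{P}}\cdots$'' means that $P^*$ attains the minimum over $\mathsf{P}$. *)

(* Defs.v *)
From HB Require Import structures.
From mathcomp Require Import all_boot all_order all_algebra.
From mathcomp Require Import reals.

Set Implicit Arguments.
Unset Strict Implicit.
Unset Printing Implicit Defensive.
Import Order.TTheory GRing.Theory Num.Theory.
Local Open Scope ring_scope.

(* Not MathComp-Analysis's matrix norm, which is the maximum of the moduli of
   the entries. *)
Definition frobenius_norm (R : realType) (m n : nat) (A : 'M[R]_(m, n)) : R :=
  Num.sqrt (\sum_(i < m) \sum_(j < n) A i j ^+ 2).

(* [x] is a minimizer of [f] over [S]; uniqueness is not required. *)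
Definition is_argmin (R : realType) (T : Type) (S : pred T) (f : T -> R)
    (x : T) : Prop :=
  S x /\ forall y : T, S y -> f x <= f y.

(* Indices run from 0, so entry [i] is [i + 1]. *)
Definition ramp (R : realType) (n : nat) : 'cV[R]_n := \col_(i < n) i.+1%:R.

Definition strictly_ascending (R : realType) (n : nat) (v : 'cV[R]_n) : Prop :=
  forall i j : 'I_n, (i < j)%N -> v i 0 < v j 0.

(* Main.v *)
Require Import Defs.
From mathcomp Require Import all_boot all_order all_algebra.
From mathcomp Require Import reals.
From mathcomp Require Import fingroup perm.
From mathcomp Require Import ring lra.
Import Order.TTheory GRing.Theory Num.Theory.
Local Open Scope ring_scope.

(** Permuting [x] does not change its norm, so minimizing [|Qx - Px|] amounts to
    maximizing [<Qx, Px>].  Here [Qx = a + P* Pb^T eps] and [<a, Px>] does not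
    depend on [P], so what remains is [<eps, Pb P*^T P x>].  For small [delta]
    the vector [Pb x] is a small perturbation of [Pb b], hence still ascending
    like [eps], and the rearrangement inequality says that the choice [P = P*],
    which gives [<eps, Pb x>], is optimal. *)

Lemma frobenius_norm_colE (R : realType) (n : nat) (v : 'cV[R]_n) :
  frobenius_norm v ^+ 2 = \sum_i v i 0 ^+ 2.
Proof.
rewrite /frobenius_norm sqr_sqrtr; last first.
  by apply: sumr_ge0 => i _; apply: sumr_ge0 => j _; apply: sqr_ge0.
by apply: eq_bigr => i _; rewrite big_ord1.
Qed.

Lemma perm_mx_mulE (R : pzSemiRingType) (n : nat) (s : 'S_n) (v : 'cV[R]_n) i :
  (perm_mx s *m v) i 0 = v (s i) 0.
Proof. by rewrite -row_permE mxE. Qed.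

Lemma sum_sqr_sub_perm (R : comPzRingType) (n : nat) (s : 'S_n)
    (x y : 'I_n -> R) :
  \sum_i (y i - x (s i)) ^+ 2 =
  \sum_i y i ^+ 2 + \sum_i x i ^+ 2 - 2%:R * \sum_i y i * x (s i).
Proof.
rewrite [\sum_i x i ^+ 2](reindex_inj (@perm_inj _ s)) mulr_sumr.
by rewrite -big_split -sumrB; apply: eq_bigr => i _ /=; ring.
Qed.

(* Subtracting [v k] from all entries changes both sums equally and makes the
   inequality hold term by term after reindexing by [s]. *)
Lemma tail_sum_perm_le (R : realDomainType) (n : nat) (v : 'I_n -> R)
    (s : 'S_n) (k : 'I_n) :
  {homo v : i j / (i <= j)%N >-> i <= j} ->
  \sum_(i < n | (k <= i)%N) v (s i) <= \sum_(i < n | (k <= i)%N) v i.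
Proof.
move=> v_homo.
suff: \sum_(i < n | (k <= i)%N) (v (s i) - v k) <=
      \sum_(i < n | (k <= i)%N) (v i - v k) by rewrite !sumrB lerD2r.
rewrite (reindex_inj (@perm_inj _ s^-1%g)) /=.
rewrite big_mkcond [leRHS]big_mkcond; apply: ler_sum => i _; rewrite permKV.
case: (leqP k i) => [ki|/ltnW ik].
  by case: ifP => // _; rewrite subr_ge0 v_homo.
by case: ifP => // _; rewrite subr_le0 v_homo.
Qed.

(** Summation by parts: the weight [i.+1] counts the indices [k <= i], so each side is the sum over
    [k] of tail sums from [k], and these compare one by one. *)
Lemma ramp_rearrangement (R : realDomainType) (n : nat) (v : 'I_n -> R)
    (s : 'S_n) :
  {homo v : i j / (i <= j)%N >-> i <= j} ->
  \sum_(i < n) i.+1%:R * v (s i) <= \sum_(i < n) i.+1%:R * v i.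
Proof.
move=> v_homo.
have tailsE (f : 'I_n -> R) :
    \sum_(i < n) i.+1%:R * f i = \sum_(k < n) \sum_(i < n | (k <= i)%N) f i.
  rewrite (exchange_big_dep predT) //=; apply: eq_bigr => i _.
  rewrite sumr_const mulr_natl; congr (_ *+ _).
  by rewrite -sum1_card (big_ord_narrow (ltn_ord i)) sum1_card card_ord.
by rewrite !tailsE; apply: ler_sum => k _; apply: tail_sum_perm_le.
Qed.

(** With [S] the sum of the ratios [|d i| / c i], each ratio is at most [1 + S], so [e = (1 + S)^-1]
    gives [e * |d i| <= c i]. The added 1 keeps [e] well defined when [S = 0]. *)
Lemma small_perturbation_ge0 (R : realFieldType) (I : finType) (P : pred I)
    (c d : I -> R) : (forall i, P i -> 0 < c i) ->
  exists2 e : R, 0 < e & forall i, P i -> 0 <= c i + e * d i.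
Proof.
move=> c_gt0; pose S := \sum_(i | P i) `|d i| / c i.
have term_ge0 i : P i -> 0 <= `|d i| / c i.
  by move=> /c_gt0/ltW ci; rewrite divr_ge0.
have S1_gt0 : 0 < 1 + S by rewrite ltr_pwDl // sumr_ge0.
exists (1 + S)^-1 => [|i Pi]; first by rewrite invr_gt0.
rewrite -lerBlDl sub0r lerNl -mulrN ler_pdivrMl // .
apply: le_trans (ler_norm _) _; rewrite normrN -ler_pdivrMr ?c_gt0 //.
rewrite /S (bigD1 i) //= addrCA lerDl addr_ge0 // sumr_ge0 // => j /andP[Pj _].
exact: term_ge0.
Qed.

Lemma ascending_perturbation (R : realType) (n : nat) (v w : 'cV[R]_n) :
  strictly_ascending v ->
  exists2 e : R, 0 < e &
    forall i j : 'I_n, (i <= j)%N -> v i 0 + e * w i 0 <= v j 0 + e * w j 0.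
Proof.
move=> v_asc.
(* The positive quantities to preserve are the gaps of [v] over all pairs [i < j]. *)
have [|e e_gt0 he] := @small_perturbation_ge0 R _
  (fun p : 'I_n * 'I_n => p.1 < p.2)%N
  (fun p => v p.2 0 - v p.1 0) (fun p => w p.2 0 - w p.1 0).
  by move=> p /v_asc; rewrite subr_gt0.
exists e => // i j; rewrite leq_eqVlt => /predU1P[/val_inj -> //|ij].
by have /= := he (i, j) ij; lra.
Qed.

Theorem theorem2 (R : realType) (n : nat) (Q : 'M[R]_n) (hQ : Q \in unitmx) :
  let a : 'cV[R]_n := (Num.sqrt n%:R)^-1 *: const_mx 1 in
  let b : 'cV[R]_n := invmx Q *m a in
  (forall i j : 'I_n, b i 0 = b j 0 -> i = j) ->
  forall Pb : 'M[R]_n, is_perm_mx Pb -> strictly_ascending (Pb *m b) ->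
  forall Pstar : 'M[R]_n, is_perm_mx Pstar ->
  exists delta : R, 0 < delta /\
    (let eps : 'cV[R]_n := delta *: ramp R n in
     let x : 'cV[R]_n := b + invmx Q *m Pstar *m Pb^T *m eps in
     is_argmin (@is_perm_mx R n)
       (fun P : 'M[R]_n => frobenius_norm (Q *m x - P *m x) ^+ 2) Pstar).
Proof.
move=> a b _ _ /is_perm_mxP[sb ->] b_asc _ /is_perm_mxP[t ->].
(* The direction [w] is free of [delta], so [e] can be chosen first to make [Pb (b + e w)]
   nondecreasing. *)
pose w := invmx Q *m perm_mx t *m (perm_mx sb)^T *m ramp R n.
have [e e_gt0 x_asc] := @ascending_perturbation R n _ (perm_mx sb *m w) b_asc.
exists e; split=> // eps x; split=> [|_ /is_perm_mxP[s ->]].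
  exact: perm_mx_is_perm.
have xE : x = b + e *: w by rewrite /x /eps -scalemxAr.
have QxE i : (Q *m x) i 0 = (Num.sqrt n%:R)^-1 + e * (sb^-1 (t i))%g.+1%:R.
  rewrite xE mulmxDr mulKVmx // -scalemxAr /w -!mulmxA mulKVmx //.
  by rewrite tr_perm_mx mxE [a _ _]mxE mxE mulr1 [X in _ + X]mxE !perm_mx_mulE mxE.
have objE (p : 'S_n) : frobenius_norm (Q *m x - perm_mx p *m x) ^+ 2 =
    \sum_i (Q *m x) i 0 ^+ 2 + \sum_i x i 0 ^+ 2
    - 2%:R * \sum_i (Q *m x) i 0 * x (p i) 0.
  rewrite frobenius_norm_colE -sum_sqr_sub_perm.
  by apply: eq_bigr => i _; rewrite mxE [in X in _ + X]mxE perm_mx_mulE.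
(* Substituting [i = t^-1 (sb k)] turns the weight into [k.+1]. Inserting [sb^-1] and [sb] expresses
   the other factor as a permutation of the nondecreasing sequence [x (sb k)]; products of
   permutations act from left to right. *)
have crossE (p : 'S_n) : \sum_i (Q *m x) i 0 * x (p i) 0 =
    (Num.sqrt n%:R)^-1 * (\sum_i x i 0) +
    e * \sum_(k < n) k.+1%:R * x (sb ((sb * t^-1 * p * sb^-1)%g k)) 0.
  rewrite [\sum_i x i 0](reindex_inj (@perm_inj _ (sb * t^-1 * p)%g)).
  rewrite [LHS](reindex_inj (@perm_inj _ (sb * t^-1)%g)).
  rewrite !mulr_sumr -big_split /=.
  apply: eq_bigr => k _; rewrite QxE !permM permKV permK permKV.
  by rewrite mulrDl mulrA.
rewrite !objE lerD2l lerN2 ler_pM2l // !crossE lerD2l ler_pM2l //.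
(* For [p = t] the permutation is the identity, which is the larger side of the rearrangement
   inequality. *)
rewrite mulgVK mulgV.
under [leRHS]eq_bigr => k _ do rewrite perm1.
apply: (@ramp_rearrangement _ _ (fun k => x (sb k) 0)) => i j ij.
by have := x_asc i j ij; rewrite !perm_mx_mulE xE !mxE.
Qed.
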